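(* Let $\sum_{n=0}^{\infty} a_n$ be a series of non-zero real numbers, and let $I\subset\mathbb{R}$ be a finite or infinite interval such that $\left|\frac{a_n}{a_{n-1}}\right|\in I$ for all $n\ge 1$. Let $f:I\to\mathbb{R}$ be a continuous injective function, and suppose that the limits $$\rho_{\mathrm{generalized}}=\lim_{N\to\infty} f^{-1}\left(\frac{1}{N}\sum_{n=1}^{N}f\left(\left|\frac{a_n}{a_{n-1}}\right|\right)\right)\quad\text{and}\quad \rho_{\mathrm{ratio}}=\lim_{n\to\infty}\frac{|a_{n+1}|}{|a_n|}$$ exist. Then the value of $\rho_{\mathrm{generalized}}$ is independent of the choice of $f$; in particular, $\rho_{\mathrm{generalized}}=\rho_{\mathrm{ratio}}$.
   Context: Here $f^{-1}:f(I)\to I$ is the inverse of $f$ onto its image; since $f(I)$ is an interval, the averages $\frac1N\sum_{n=1}^N f(|a_n/a_{n-1}|)$ lie in $f(I)$. Limits may be finite or infinite (i.e. in $[0,\infty]$). *)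

(* Defs.v *)
From mathcomp Require Import all_boot all_order all_algebra.
From mathcomp Require Import all_classical all_reals all_analysis.

Set Implicit Arguments.
Unset Strict Implicit.
Unset Printing Implicit Defensive.

Import Order.TTheory GRing.Theory Num.Theory.
Import numFieldNormedType.Exports.

Local Open Scope classical_set_scope.
Local Open Scope ring_scope.

(* A function on I is represented by a total function f : R -> R of which only
   the values on I are used.  [pinv] is its inverse from the image of I onto I
   and takes junk values outside that image; the average below lies in the image
   as soon as f is continuous on I, the ratios lie in I and N > 0.  The value at
   N = 0 is also junk, and does not affect limits in N. *)
Definition generalized_mean_ratio (R : realType) (I : interval R)
    (f : R -> R) (a : R^nat) : R^nat :=
  fun N => pinv [set` I] f
    (N%:R^-1 * \sum_(1 <= n < N.+1) f `|a n / a n.-1|).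

(* Limits are taken in the extended reals, so that they may be infinite. *)
Definition generalized_seq (R : realType) (I : interval R)
    (f : R -> R) (a : R^nat) : (\bar R)^nat :=
  fun N => (generalized_mean_ratio I f a N)%:E.

Definition ratio_seq (R : realType) (a : R^nat) : (\bar R)^nat :=
  fun n => (`|a n.+1| / `|a n|)%:E.

Definition rho_generalized (R : realType) (I : interval R)
    (f : R -> R) (a : R^nat) : \bar R := limn (generalized_seq I f a).

Definition rho_ratio (R : realType) (a : R^nat) : \bar R := limn (ratio_seq a).

(* Main.v *)
Require Import Defs.
From mathcomp Require Import all_boot all_order all_algebra.
From mathcomp Require Import all_classical all_reals all_analysis.
From mathcomp Require Import lra.

Import Order.TTheory GRing.Theory Num.Theory.
Import numFieldNormedType.Exports.

Local Open Scope classical_set_scope.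
Local Open Scope ring_scope.

(** Write r for the sequence of ratios and M for the sequence of generalized
    means, so that f (M n) is the arithmetic mean of f (r 0), ..., f (r n).
    A continuous injection on an interval is strictly monotone; the opposite of
    f has the same means, so let f be increasing.

    Suppose that lim M < lim r and choose reals with lim M < c < c' < lim r.
    Eventually r n >= c'.  If c lies in I, then so does c', eventually
    f (r n) >= f c' > f c, so the arithmetic means of f (r n) end up above f c,
    and M ends up above c.  If c does not lie in I, then I, being an interval
    that meets the reals above c, lies entirely above c, and M does too.  Both
    contradict lim M < c.  This is [lim_le_lim_quasi_mean].  The reflection
    x |-> - x turns it into the other inequality.

    Comparing with real thresholds, instead of passing to the limit in
    f and in its inverse, treats at once the limits that lie in I, those that
    are an endpoint outside I, where f may be unbounded, and the infinite
    ones. *)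

Lemma arithmetic_meanN {R : realType} (u : R^nat) (n : nat) :
  arithmetic_mean (fun k => - u k) n = - arithmetic_mean u n.
Proof. by rewrite /arithmetic_mean /series /= sumrN mulrN. Qed.

Lemma le_arithmetic_mean {R : realType} (u v : R^nat) (n : nat) :
  (forall k, u k <= v k) -> arithmetic_mean u n <= arithmetic_mean v n.
Proof.
move=> uv; rewrite /arithmetic_mean /series /=.
by apply: ler_wpM2l; [rewrite invr_ge0 | apply: ler_sum].
Qed.

Lemma arithmetic_meanS {R : realType} (u : R^nat) (n : nat) :
  n.+2%:R * arithmetic_mean u n.+1 = n.+1%:R * arithmetic_mean u n + u n.+1.
Proof.
rewrite /arithmetic_mean /series /= !mulrA !divff ?pnatr_eq0// !mul1r.
by rewrite big_nat_recr.
Qed.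

(** Each mean is a convex combination of the preceding one and the new term. *)
Lemma arithmetic_mean_in_interval {R : realType} {B : set R} (u : R^nat)
    (n : nat) :
  is_interval B -> (forall k, B (u k)) -> B (arithmetic_mean u n).
Proof.
move=> itvB Bu; elim: n => [|n IHn].
  by rewrite /arithmetic_mean /series /= big_nat1 invr1 mul1r.
have := arithmetic_meanS u n.
rewrite -(natr1 n.+1).
have : (0 : R) < n.+1%:R by rewrite ltr0n.
move: IHn (Bu n.+1); set m := arithmetic_mean u n; set m' := arithmetic_mean u n.+1.
move: (n.+1%:R) (u n.+1) => N x Bm Bx N0 mE.
case: (leP m x) => mx.
- by apply: (itvB m x) => //; apply/andP; split; nra.
- by apply: (itvB x m) => //; apply/andP; split; nra.
Qed.

(** Truncating the sequence at [w] makes it converge to [w], so that Cesaro's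
    lemma applies to a minorant. *)
Lemma arithmetic_mean_gt {R : realType} {u : R^nat} {v w : R} :
  v < w -> (\forall n \near \oo, w <= u n) ->
  \forall n \near \oo, v < arithmetic_mean u n.
Proof.
move=> vw uw.
have : arithmetic_mean (fun n => Num.min (u n) w) @ \oo --> w.
  by apply: cesaro; apply: cvg_near_cst; apply: filterS uw => n /min_r.
move=> /(cvgr_gt w) /(_ _ vw); apply: filterS => n /lt_le_trans; apply.
by apply: le_arithmetic_mean => k; rewrite ge_min lexx.
Qed.

(** If [c] is outside the interval [A], all of [A] is above [c]; otherwise [c]
    and [c'] can be compared with the means through [g]. *)
Lemma quasi_mean_gt {R : realType} {A : set R} {g : R -> R} {r M : R^nat}
    {c c' : R} :
  is_interval A -> (forall x y, A x -> A y -> x < y -> g x < g y) ->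
  (forall n, A (r n)) -> (forall n, A (M n)) ->
  (forall n, g (M n) = arithmetic_mean (g \o r) n) ->
  c < c' -> (\forall n \near \oo, c' <= r n) ->
  \forall n \near \oo, c < M n.
Proof.
move=> itvA g_incr Ar AM gM cc' rc'.
have [m /= c'rm] := filter_ex rc'.
have g_ndecr x y : A x -> A y -> x <= y -> g x <= g y.
  move=> Ax Ay; rewrite le_eqVlt => /predU1P[->//|xy].
  exact/ltW/g_incr.
have [Ac|nAc] := pselect (A c); last first.
  apply: nearW => n; rewrite ltNge; apply/negP => Mc; apply: nAc.
  by apply: (itvA (M n) (r m)) => //; rewrite Mc (le_trans (ltW cc')).
have Ac' : A c' by apply: (itvA c (r m)) => //; rewrite (ltW cc').
have : \forall n \near \oo, g c < arithmetic_mean (g \o r) n.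
  apply: (@arithmetic_mean_gt _ _ _ (g c')); first exact: g_incr.
  by apply: filterS rc' => n; exact: g_ndecr.
apply: filterS => n; rewrite -gM => gcM; rewrite ltNge; apply/negP => Mc.
by move: gcM; rewrite ltNge g_ndecr.
Qed.

Lemma ereal_lt_dense_real {R : realType} {x y : \bar R} :
  (x < y)%E -> exists c : R, (x < c%:E < y)%E.
Proof.
case: x y => [x| |] [y| |] //=.
- rewrite lte_fin => xy; exists ((x + y) / 2).
  by rewrite !lte_fin midf_lt// ; apply/andP; split; lra.
- by move=> _; exists (x + 1); rewrite lte_fin ltry ltrDl ltr01.
- by move=> _; exists (y - 1); rewrite lte_fin ltNyr ltrBlDr ltrDl ltr01.
- by move=> _; exists 0; rewrite ltNyr ltry.
Qed.

Lemma lim_le_lim_quasi_mean {R : realType} {A : set R} {g : R -> R}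
    {r M : R^nat} {l rho : \bar R} :
  is_interval A -> (forall x y, A x -> A y -> x < y -> g x < g y) ->
  (forall n, A (r n)) -> (forall n, A (M n)) ->
  (forall n, g (M n) = arithmetic_mean (g \o r) n) ->
  (M n)%:E @[n --> \oo] --> l -> (r n)%:E @[n --> \oo] --> rho ->
  (rho <= l)%E.
Proof.
move=> itvA g_incr Ar AM gM Ml rrho; rewrite leNgt; apply/negP => lrho.
have [c' /andP[lc' c'rho]] := ereal_lt_dense_real lrho.
have [c /andP[lc cc']] := ereal_lt_dense_real lc'.
have near_r : \forall n \near \oo, c' <= r n.
  have : \forall n \near \oo, (c'%:E < (r n)%:E)%E.
    exact: (rrho _ (open_ereal_gt' c'rho)).
  by apply: filterS => n; rewrite lte_fin => /ltW.
rewrite lte_fin in cc'.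
have cM : \forall n \near \oo, c < M n.
  exact: (quasi_mean_gt itvA g_incr Ar AM gM cc' near_r).
have Mc : \forall n \near \oo, ((M n)%:E < c%:E)%E.
  exact: (Ml _ (open_ereal_lt' lc)).
have [n [cMn]] := filter_ex (filterI cM Mc).
by rewrite lte_fin => /(lt_trans cMn); rewrite ltxx.
Qed.

Lemma lim_quasi_mean_incr {R : realType} {A : set R} {g : R -> R}
    {r M : R^nat} {l rho : \bar R} :
  is_interval A -> (forall x y, A x -> A y -> x < y -> g x < g y) ->
  (forall n, A (r n)) -> (forall n, A (M n)) ->
  (forall n, g (M n) = arithmetic_mean (g \o r) n) ->
  (M n)%:E @[n --> \oo] --> l -> (r n)%:E @[n --> \oo] --> rho ->
  l = rho.
Proof.
move=> itvA g_incr Ar AM gM Ml rrho; apply/le_anti/andP; split; last first.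
  exact: (lim_le_lim_quasi_mean itvA g_incr Ar AM gM).
rewrite -leeN2.
(* The point reflection of the graph of [g] is again increasing, and it has
   the reflected means. *)
apply: (@lim_le_lim_quasi_mean _ [set x | A (- x)] (fun x => - g (- x))
  (fun n => - r n) (fun n => - M n)).
- move=> x y /= Ax Ay z /andP[xz zy] /=.
  by apply: (itvA (- y) (- x)) => //; rewrite !lerN2 zy.
- by move=> x y /= Ax Ay xy; rewrite ltrN2 g_incr// ltrN2.
- by move=> n /=; rewrite opprK.
- by move=> n /=; rewrite opprK.
- move=> n; rewrite opprK gM -arithmetic_meanN; congr arithmetic_mean.
  by apply/funext => k /=; rewrite opprK.
- exact: (cvgeN Ml).
- exact: (cvgeN rrho).
Qed.

(** Replacing [g] by its opposite does not change the means that it defines. *)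
Lemma lim_quasi_mean {R : realType} {I : interval R} {g : R -> R}
    {r M : R^nat} {l rho : \bar R} :
  {within [set` I], continuous g} -> {in I &, injective g} ->
  (forall n, r n \in I) -> (forall n, M n \in I) ->
  (forall n, g (M n) = arithmetic_mean (g \o r) n) ->
  (M n)%:E @[n --> \oo] --> l -> (r n)%:E @[n --> \oo] --> rho ->
  l = rho.
Proof.
move=> g_cont g_inj Ir IM gM.
have itvI := @interval_is_interval _ I.
have [g_incr|g_decr] := itv_continuous_inj_mono g_cont g_inj.
  exact: (lim_quasi_mean_incr itvI g_incr).
apply: (@lim_quasi_mean_incr _ _ (fun x => - g x) _ _ _ _ itvI) => //.
- by move=> x y Ix Iy xy; rewrite ltrN2; exact: g_decr.
- by move=> n; rewrite gM -arithmetic_meanN.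
Qed.

(** By the intermediate value theorem the image of [I] is an interval, so it
    contains the average to which the inverse of [f] is applied. *)
Lemma generalized_mean_ratioP {R : realType} {I : interval R}
    {f : R -> R} {a : R^nat} (n : nat) :
  (forall n, (1 <= n)%N -> `|a n / a n.-1| \in I) ->
  {within [set` I], continuous f} ->
  generalized_mean_ratio I f a n.+1 \in I /\
  f (generalized_mean_ratio I f a n.+1) =
    arithmetic_mean (f \o (fun k => `|a k.+1 / a k|)) n.
Proof.
move=> ratio_in_I f_cont; rewrite /generalized_mean_ratio big_add1 /=.
set m := (X in pinv _ _ X).
suff fI_m : (f @` [set` I]) m.
  split; last by rewrite pinvK// inE.
  have f_surj : set_surj [set` I] (f @` [set` I]) f by [].
  by apply: (surjpinv_image_sub f_surj); exists m.
apply: arithmetic_mean_in_interval; last first.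
  by move=> k /=; exists `|a k.+1 / a k| => //; exact: (ratio_in_I k.+1).
apply/connected_intervalP/connected_continuous_connected => //.
exact/connected_intervalP/interval_is_interval.
Qed.

Lemma rho_generalized_eq_ratio {R : realType} {I : interval R}
    {f : R -> R} {a : R^nat} :
  (forall n, (1 <= n)%N -> `|a n / a n.-1| \in I) ->
  {within [set` I], continuous f} ->
  {in I &, injective f} -> cvgn (generalized_seq I f a) ->
  cvgn (ratio_seq a) -> rho_generalized I f a = rho_ratio a.
Proof.
move=> ratio_in_I f_cont f_inj cvg_gen cvg_ratio.
apply: (@lim_quasi_mean _ _ _ (fun k => `|a k.+1 / a k|)
  (fun n => generalized_mean_ratio I f a n.+1) _ _ f_cont f_inj).
- by move=> n; exact: (ratio_in_I n.+1).
- by move=> n; case: (generalized_mean_ratioP n ratio_in_I f_cont).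
- by move=> n; case: (generalized_mean_ratioP n ratio_in_I f_cont).
(* The mean at [N = 0] is a junk value, hence the shift of the sequence. *)
- by have := cvg_gen; rewrite -[X in X -> _]cvg_shiftS.
- by under eq_fun do rewrite normf_div.
Qed.

Theorem theorem2p8 (R : realType) (a : R^nat) (I : interval R)
    (a_neq0 : forall n, a n != 0)
    (ratio_in_I : forall n, (1 <= n)%N -> `|a n / a n.-1| \in I)
    (f : R -> R)
    (f_cont : {within [set` I], continuous f})
    (f_inj : {in I &, injective f})
    (cvg_generalized : cvgn (generalized_seq I f a))
    (cvg_ratio : cvgn (ratio_seq a)) :
  (forall g : R -> R,
      {within [set` I], continuous g} ->
      {in I &, injective g} ->
      cvgn (generalized_seq I g a) ->
      rho_generalized I g a = rho_generalized I f a) /\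
  rho_generalized I f a = rho_ratio a.
Proof.
have fE : rho_generalized I f a = rho_ratio a.
  exact: rho_generalized_eq_ratio.
by split=> // g g_cont g_inj cvg_g; rewrite fE; exact: rho_generalized_eq_ratio.
Qed.
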